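(* Let $M$ be a Riemannian manifold, let $\mu$ be a Borel probability measure on $M$ and $\nu$ a positive Borel measure on $M$. For $q\in(0,1)$ let $$\beta_{LS}:=\sup\Big\{\sum_{k\in\mathbb Z}\frac{\Big[\mu(\Omega_k)\log\Big(1+\frac{e^2}{\mu(\Omega_k)}\Big)\Big]^{1/(1-q)}}{[\mathrm{Cap}_\nu(\Omega_k,\Omega_{k+1})]^{q/(1-q)}}\Big\}^{(1-q)/q},$$ where the supremum is taken over all measurable $\Omega\subset M$ with $\mu(\Omega)\le1/2$ and all sequences $(\Omega_k)_{k\in\mathbb Z}$ of measurable sets such that $\Omega_k\subset\Omega_{k+1}\subset\Omega$ for all $k\in\mathbb Z$. If $q\in(0,1)$ and $\beta_{LS}<+\infty$, then $(\mu,\nu)$ satisfies an $L^q$-logarithmic Sobolev inequality with a constant $C_{LS}\le\kappa_{LS}\,\beta_{LS}$, where $\kappa_{LS}$ depends only on $q$.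
   Context: For $q\in(0,1]$, $(\mu,\nu)$ satisfies an $L^q$-logarithmic Sobolev inequality with constant $C_{LS}$ if for all non-negative $f\in C^1(M)$ $$\big[\mathrm{Ent}_\mu(f^{2q})\big]^{1/q}\le C_{LS}\int|\nabla f|^2d\nu,\qquad \mathrm{Ent}_\mu(g):=\int g\log\Big(\frac{g}{\int g\,d\mu}\Big)d\mu\quad(g\ge0).$$ For measurable $A\subset\Omega\subset M$, $\mathrm{Cap}_\nu(A,\Omega):=\inf\{\int|\nabla f|^2d\nu: f\in C^1(M),\ \mathbb 1_A\le f\le\mathbb 1_\Omega\}$, with $\mathrm{Cap}_\nu(A,\Omega):=+\infty$ if there is no such $f$. In the sum, $x\log(1+e^2/x)$ is $0$ at $x=0$, a term with infinite capacity is $0$, a term with $\mu(\Omega_k)>0$ and zero capacity is $+\infty$, and $0/0$ is read as $0$. *)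

(* Defs.v *)
From mathcomp Require Import all_boot all_order all_algebra.
From mathcomp Require Import all_classical all_reals all_analysis.

Set Implicit Arguments.
Unset Strict Implicit.
Unset Printing Implicit Defensive.

Import Order.TTheory GRing.Theory Num.Theory.
Import numFieldNormedType.Exports.

Local Open Scope classical_set_scope.
Local Open Scope ring_scope.

Definition partial (R : realType) (n : nat) (i : 'I_n) (f : 'rV[R]_n -> R) :
    'rV[R]_n -> R :=
  fun y => 'D_(delta_mx 0 i : 'rV[R]_n) f y.

Fixpoint Ck (R : realType) (n k : nat) (U : set 'rV[R]_n) (f : 'rV[R]_n -> R) :
    Prop :=
  {in U, continuous f} /\
  if k is k'.+1 then
    forall i : 'I_n,
      (forall y, U y -> derivable f y (delta_mx 0 i : 'rV[R]_n)) /\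
      Ck k' U (partial i f)
  else True.

Definition smooth (R : realType) (n : nat) (U : set 'rV[R]_n)
    (f : 'rV[R]_n -> R) : Prop :=
  forall k, Ck k U f.

Record chart (R : realType) (n : nat) (M : ptopologicalType) := Chart {
  chart_dom : set M;
  chart_cod : set 'rV[R]_n;
  chart_coord : M -> 'rV[R]_n;
  chart_param : 'rV[R]_n -> M;
  chart_dom_open : open chart_dom;
  chart_cod_open : open chart_cod;
  chart_coord_cod : forall x, chart_dom x -> chart_cod (chart_coord x);
  chart_param_dom : forall y, chart_cod y -> chart_dom (chart_param y);
  chart_coordK : {in chart_dom, cancel chart_coord chart_param};
  chart_paramK : {in chart_cod, cancel chart_param chart_coord};
  chart_coord_continuous : {in chart_dom, continuous chart_coord};
  chart_param_continuous : {in chart_cod, continuous chart_param} }.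

Definition overlap (R : realType) (n : nat) (M : ptopologicalType)
    (a b : chart R n M) : set 'rV[R]_n :=
  [set y | chart_cod a y /\ chart_dom b (chart_param a y)].

Definition transition (R : realType) (n : nat) (M : ptopologicalType)
    (a b : chart R n M) (j : 'I_n) : 'rV[R]_n -> R :=
  fun y => chart_coord b (chart_param a y) 0 j.

(* Tangent vectors are row vectors: [v] in the chart [a] is
   [v *m transition_jacobian a b x] in the chart [b]. *)
Definition transition_jacobian (R : realType) (n : nat) (M : ptopologicalType)
    (a b : chart R n M) (x : M) : 'M[R]_n :=
  \matrix_(i, j) partial i (transition a b j) (chart_coord a x).

(* [rm_metric a x] is the matrix (g_ij) of the metric at [x] in the chart [a];
   it is only meaningful for [x] in the domain of [a].  [rm_chart_at x] is an
   arbitrary chart of the atlas around [x]. *)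
Record riemannianManifold (R : realType) (n : nat) := RiemannianManifold {
  rm_carrier :> ptopologicalType;
  rm_hausdorff : hausdorff_space rm_carrier;
  rm_second_countable : @second_countable rm_carrier;
  rm_index : Type;
  rm_atlas : rm_index -> chart R n rm_carrier;
  rm_chart_at : rm_carrier -> rm_index;
  rm_chart_atP : forall x, chart_dom (rm_atlas (rm_chart_at x)) x;
  rm_transition_smooth : forall a b j,
    smooth (overlap (rm_atlas a) (rm_atlas b))
           (transition (rm_atlas a) (rm_atlas b) j);
  rm_metric : rm_index -> rm_carrier -> 'M[R]_n;
  rm_metric_sym : forall a x, chart_dom (rm_atlas a) x ->
    (rm_metric a x)^T = rm_metric a x;
  rm_metric_pos : forall a x, chart_dom (rm_atlas a) x ->
    forall v : 'rV[R]_n, v != 0 -> 0 < (v *m rm_metric a x *m v^T) 0 0;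
  rm_metric_smooth : forall a i j,
    smooth (chart_cod (rm_atlas a))
           (fun y => rm_metric a (chart_param (rm_atlas a) y) i j);
  rm_metric_compat : forall a b x,
    chart_dom (rm_atlas a) x -> chart_dom (rm_atlas b) x ->
    let J := transition_jacobian (rm_atlas a) (rm_atlas b) x in
    rm_metric a x = J *m rm_metric b x *m J^T }.

Definition C1 (R : realType) (n : nat) (M : riemannianManifold R n)
    (f : M -> R) : Prop :=
  forall a : rm_index M,
    Ck 1 (chart_cod (rm_atlas a)) (f \o chart_param (rm_atlas a)).

(* In coordinates, grad f has components \sum_i (partial_i f) g^ij. *)
Definition grad_coord (R : realType) (n : nat) (M : riemannianManifold R n)
    (a : rm_index M) (f : M -> R) (x : M) : 'rV[R]_n :=
  (\row_i partial i (f \o chart_param (rm_atlas a))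
                    (chart_coord (rm_atlas a) x)) *m invmx (rm_metric a x).

(* |grad f|^2 = g(grad f, grad f); for [f] of class C^1 this does not depend on
   the chart, by [rm_metric_compat]. *)
Definition grad_normsq (R : realType) (n : nat) (M : riemannianManifold R n)
    (f : M -> R) (x : M) : R :=
  let a := rm_chart_at x in
  let v := grad_coord a f x in
  (v *m rm_metric a x *m v^T) 0 0.

Definition borel (T : ptopologicalType) := g_sigma_algebraType (@open T).

Local Open Scope ereal_scope.

Definition energy (R : realType) (n : nat) (M : riemannianManifold R n)
    (nu : {measure set (borel M) -> \bar R}) (f : M -> R) : \bar R :=
  \int[nu]_x (grad_normsq f x)%:E.

(* Ent_mu(g) for g >= 0, with the usual convention Ent_mu(g) = +oo when [g] is
   not integrable.  The conventions [ln 0 = 0] and [x / 0 = 0] on [R] give the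
   integrand the value 0 where [g = 0], and when [g] is null almost everywhere. *)
Definition entropy (R : realType) (T : ptopologicalType)
    (mu : probability (borel T) R) (g : T -> R) : \bar R :=
  let m := \int[mu]_x (g x)%:E in
  if m == +oo then +oo
  else \int[mu]_x (g x * ln (g x / fine m))%R%:E.

(* When the energy is infinite the right-hand side is read as +oo, even for
   [C = 0] (whereas [0 * +oo = 0] in [\bar R]). *)
Definition Lq_logSobolev (R : realType) (n : nat) (M : riemannianManifold R n)
    (q : R) (mu : probability (borel M) R)
    (nu : {measure set (borel M) -> \bar R}) (C : R) : Prop :=
  forall f : M -> R, C1 f -> (forall x, (0 <= f x)%R) ->
    energy nu f < +oo ->
    (entropy mu (fun x => f x `^ (2 * q))%R) `^ (q^-1) <= C%:E * energy nu f.

Definition capacity (R : realType) (n : nat) (M : riemannianManifold R n)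
    (nu : {measure set (borel M) -> \bar R}) (A Om : set M) : \bar R :=
  ereal_inf [set energy nu f | f in
    [set f : M -> R | C1 f /\ forall x, (\1_A x <= f x <= \1_Om x)%R]].

(* In [\bar R], 0^-1 = +oo, +oo^-1 = 0 and 0 * +oo = 0; in [R], x / 0 = 0. *)
Definition LS_term (R : realType) (n : nat) (M : riemannianManifold R n)
    (q : R) (mu : probability (borel M) R)
    (nu : {measure set (borel M) -> \bar R}) (A B : set M) : \bar R :=
  let m := fine (mu A) in
  ((m * ln (1 + expR 2 / m)) `^ (1 / (1 - q)))%R%:E
    / (capacity nu A B) `^ (q / (1 - q))%R.

Definition beta_LS (R : realType) (n : nat) (M : riemannianManifold R n)
    (q : R) (mu : probability (borel M) R)
    (nu : {measure set (borel M) -> \bar R}) : \bar R :=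
  (ereal_sup [set s : \bar R |
     exists (Om : set (borel M)) (Omk : int -> set (borel M)),
     [/\ measurable Om,
         mu Om <= (1 / 2)%R%:E,
         forall k, measurable (Omk k),
         forall k, Omk k `<=` Omk (k + 1)%R /\ Omk (k + 1)%R `<=` Om &
         s = \esum_(k in [set: int]) LS_term q mu nu (Omk k) (Omk (k + 1)%R)]])
    `^ ((1 - q) / q)%R.

(* Main.v *)
Require Import Defs.
From mathcomp Require Import all_boot all_order all_algebra.
From mathcomp Require Import all_classical all_reals all_analysis.
From mathcomp Require Import measurable_realfun ring lra.

Import Order.TTheory GRing.Theory Num.Theory.
Import numFieldNormedType.Exports.

Local Open Scope ring_scope.
Local Open Scope ereal_scope.

(** Slice [f] at the levels [m +- exp (-j)] around a median [m] of [f] under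
    [mu].  A smooth truncation of [f] between two consecutive levels bounds the
    capacity of the layer by [exp (2j)] times the part of the energy carried by
    that layer; since the layers are disjoint, Hoelder's inequality with
    exponents [1/q] and [1/(1-q)] gives
    [\sum_j exp (-2qj) * L (mu {|f - m| > exp (-j)}) <= J], where
    [L x = x ln (1 + e^2/x)] and [J] is a multiple of [(beta_LS * energy f)^q].
    By the variational formula [Ent g <= \int (g ln (g/c) - g + c)] with
    [g = f^(2q)] and [c = m^(2q) + J], it remains to bound the integrand layer by
    layer.  The logarithm that appears on high layers is controlled by
    [ln (1 + e^2/x)] because each single term of the sum is already at most [J]. *)

(** * Chain rule for [C1] functions on the manifold *)

Section chain_rule.
Local Open Scope classical_set_scope.
Local Open Scope ring_scope.
Set Implicit Arguments.
Unset Strict Implicit.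

(** Restricting [f] to the line [h *: v + x] reduces this to the one-variable chain rule, so a
    directional derivative of [f] suffices. *)
Lemma is_derive_comp (R : realType) (V : normedModType R) (f : V -> R)
    (g : R -> R) (x v : V) (a b : R) :
  is_derive x v f a -> is_derive (f x) 1 g b ->
  is_derive x v (g \o f) (b * a).
Proof.
move=> [df fa] [dg gb].
pose F := fun h : R => f (h *: v + x).
have F0 : F 0 = f x by rewrite /F scale0r add0r.
have dF : derivable F 0 1 by exact: (proj1 (derivable1P f x v)).
have DE (k : V -> R) : 'D_v k x = 'D_1 (fun h : R => k (h *: v + x)) 0.
  rewrite /derive; set g1 := fun h => h^-1 *: _.
  set g2 := fun h => h^-1 *: _; suff -> : g1 = g2 by [].
  rewrite funeqE /g1 /g2 => h /=.
  by rewrite addr0 scale0r add0r [_%:A]mulr1.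
have dF' : is_derive (0 : R) 1 F a by split=> //; rewrite /F -DE.
have dg' : is_derive (F 0) 1 g b by rewrite F0; split.
have [dc ec] := @is_derive1_comp R g F 0 b a dg' dF'.
split; first by apply: (proj2 (derivable1P _ _ _)).
by rewrite DE.
Qed.

Variables (R : realType) (n : nat) (M : riemannianManifold R n).

(** [C1] speaks only of chart expressions; near [x], [f] is its chart expression composed with the
    continuous chart map. *)
Lemma C1_continuous (f : M -> R) : C1 f -> continuous f.
Proof.
move=> fC x.
pose a := rm_chart_at x; pose phi := chart_coord (rm_atlas a).
have xa : chart_dom (rm_atlas a) x by exact: rm_chart_atP.
have [fc _] := fC a.
have E : {near x, (f \o chart_param (rm_atlas a)) \o phi =1 f}.
  have : nbhs x (chart_dom (rm_atlas a)).
    by apply: open_nbhs_nbhs; split=> //; exact: chart_dom_open.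
  apply: filterS => y ya; rewrite /= /phi chart_coordK ?inE//.
rewrite /continuous_at.
rewrite -(nbhs_singleton E).
apply: cvg_trans (near_eq_cvg E) _.
apply: continuous_comp.
  by apply: chart_coord_continuous; rewrite inE.
by apply: fc; rewrite inE; exact: chart_coord_cod.
Qed.

(** In every chart the partial derivatives are multiplied by [g' (f x)], and [grad_normsq] is
    quadratic in them. It serves for the truncations between levels and for the shifts by the
    median. *)
Lemma C1_comp (f : M -> R) (g g' : R -> R) : C1 f ->
  (forall t : R, is_derive t 1 g (g' t)) -> continuous g' ->
  C1 (g \o f) /\
  forall x, grad_normsq (g \o f) x = g' (f x) ^+ 2 * grad_normsq f x.
Proof.
move=> fC dg g'c.
have gc : continuous g.
  move=> t; apply/differentiable_continuous/derivable1_diffP.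
  by have [] := dg t.
have dfa (a : rm_index M) i y : chart_cod (rm_atlas a) y ->
   is_derive y (delta_mx 0 i) (g \o f \o chart_param (rm_atlas a))
    (g' (f (chart_param (rm_atlas a) y)) *
       partial i (f \o chart_param (rm_atlas a)) y).
  move=> ya; have [_ /(_ i)[df _]] := fC a.
  rewrite -compA; apply: is_derive_comp => //.
  by apply: DeriveDef => //; exact: df.
split=> [a|x].
  have [fc fd] := fC a.
  split=> [y ya|i].
    by rewrite -compA; apply: continuous_comp; [exact: fc|exact: gc].
  have [df [pc _]] := fd i.
  split=> [y ya|]; first by have [] := dfa a i y ya.
  split=> // y ya.
  have ya' : chart_cod (rm_atlas a) y by rewrite inE in ya.
  have E : {near y, (fun y => g' (f (chart_param (rm_atlas a) y)) *
       partial i (f \o chart_param (rm_atlas a)) y) =1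
       partial i (g \o f \o chart_param (rm_atlas a))}.
    have : nbhs y (chart_cod (rm_atlas a)).
      by apply: open_nbhs_nbhs; split=> //; exact: chart_cod_open.
    by apply: filterS => z za; have [_ <-] := dfa a i z za.
  rewrite /continuous_at.
  rewrite -(nbhs_singleton E).
  apply: cvg_trans (near_eq_cvg E) _.
  apply: cvgM; last exact: pc.
  apply: (@continuous_comp _ _ _ (f \o chart_param (rm_atlas a)) g').
    exact: fc.
  exact: g'c.
rewrite /grad_normsq /grad_coord; set a := rm_chart_at x.
have xa : chart_cod (rm_atlas a) (chart_coord (rm_atlas a) x).
  by apply: chart_coord_cod; exact: rm_chart_atP.
set r := \row_i _; set s := \row_i _.
have -> : r = g' (f x) *: s.
  apply/rowP => i; rewrite !mxE /partial.
  have [_ ->] := dfa a i _ xa.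
  by rewrite chart_coordK// inE; exact: rm_chart_atP.
by rewrite -!scalemxAl linearZ/= -scalemxAr !mxE/= expr2 mulrA.
Qed.

Lemma grad_normsq_ge0 (f : M -> R) x : 0 <= grad_normsq f x.
Proof.
rewrite /grad_normsq; set v := grad_coord _ _ _.
have [->|v0] := eqVneq v 0; first by rewrite !mul0mx mxE.
by apply/ltW/rm_metric_pos => //; exact: rm_chart_atP.
Qed.

End chain_rule.

(** * Superadditivity of the lower integral *)

(* For a nonnegative function, [integral] is the supremum over simple functions
   below it, so these inequalities need no measurability; this avoids proving
   that [grad_normsq f], defined through arbitrary charts, is measurable. *)
Section lower_integral.
Local Open Scope ereal_scope.
Set Implicit Arguments.
Unset Strict Implicit.
Context d (T : measurableType d) (R : realType).
Variable mu : {measure set T -> \bar R}.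
Import HBNNSimple.

Lemma ge0_le_integral_nm (f g : T -> \bar R) : (forall x, 0 <= f x) ->
  (forall x, f x <= g x) -> \int[mu]_x f x <= \int[mu]_x g x.
Proof.
move=> f0 fg; have g0 x : 0 <= g x by apply: le_trans (fg x).
rewrite !ge0_integralTE//.
apply: ereal_sup_le => _ [h /= hf <-]; by exists h => //= x; exact: (le_trans (hf x) (fg x)).
Qed.

Lemma ge0_le_integralD_nm (f g : T -> \bar R) :
  (forall x, 0 <= f x) -> (forall x, 0 <= g x) ->
  \int[mu]_x f x + \int[mu]_x g x <= \int[mu]_x (f x + g x).
Proof.
move=> f0 g0.
have fg0 x : 0 <= f x + g x by rewrite adde_ge0.
(* The infinite case is trivial. Otherwise both integrals are finite, and the two suprema over
   simple functions can be taken one after the other by moving terms across the inequality. *)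
have [->|fgy] := eqVneq (\int[mu]_x (f x + g x)) +oo; first by rewrite leey.
have fgfin : \int[mu]_x (f x + g x) \is a fin_num.
  by rewrite ge0_fin_numE ?integral_ge0// ltey.
have bnd (h k : {nnsfun T >-> R}) : (forall x, (h x)%:E <= f x) ->
    (forall x, (k x)%:E <= g x) ->
    sintegral mu h + sintegral mu k <= \int[mu]_x (f x + g x).
  move=> hf kg; rewrite -sintegralD ge0_integralTE//.
  apply: ereal_sup_ubound; exists (add_nnsfun h k) => //= x.
  by rewrite EFinD leeD.
have hfin (h : {nnsfun T >-> R}) : (forall x, (h x)%:E <= f x) ->
    sintegral mu h \is a fin_num.
  move=> hf; rewrite ge0_fin_numE ?sintegral_ge0//.
  rewrite (le_lt_trans _ (_ : \int[mu]_x (f x + g x) < +oo)) ?ltey//.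
  rewrite -[leLHS]adde0 -(sintegral0 mu).
  by apply: (bnd h nnsfun0).
rewrite -leeBrDr; last first.
  rewrite ge0_fin_numE ?integral_ge0//.
  rewrite (le_lt_trans _ (_ : \int[mu]_x (f x + g x) < +oo)) ?ltey//.
  by apply: ge0_le_integral_nm => // x; rewrite leeDr.
rewrite [leLHS]ge0_integralTE//; apply: ge_ereal_sup => _ [h /= hf <-].
rewrite leeBrDr; last first.
  rewrite ge0_fin_numE ?integral_ge0//.
  rewrite (le_lt_trans _ (_ : \int[mu]_x (f x + g x) < +oo)) ?ltey//.
  by apply: ge0_le_integral_nm => // x; rewrite leeDr.
rewrite addeC -leeBrDr ?hfin//.
rewrite [leLHS]ge0_integralTE//; apply: ge_ereal_sup => _ [k /= kg <-].
by rewrite leeBrDr ?hfin// addeC bnd.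
Qed.

Lemma ge0_le_integralZl_nm (c : R) (f : T -> \bar R) : (0 < c)%R ->
  (forall x, 0 <= f x) ->
  c%:E * \int[mu]_x f x <= \int[mu]_x (c%:E * f x).
Proof.
move=> c0 f0; rewrite -lee_pdivlMl//.
rewrite [leLHS]ge0_integralTE//; apply: ge_ereal_sup => _ [h /= hf <-].
rewrite lee_pdivlMl// -sintegralrM ge0_integralTE; last first.
  by move=> x; rewrite mule_ge0// lee_fin ltW.
apply: ereal_sup_ubound; exists (scale_nnsfun h (ltW c0)) => //= x.
by rewrite EFinM lee_pmul2l.
Qed.

Lemma ge0_le_integral_sum_nm (I : Type) (s : seq I) (f : I -> T -> \bar R) :
  (forall i x, 0 <= f i x) ->
  \sum_(i <- s) \int[mu]_x f i x <= \int[mu]_x \sum_(i <- s) f i x.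
Proof.
move=> f0; elim: s => [|i s ih].
  by rewrite big_nil integral_ge0// => x _; rewrite big_nil.
rewrite big_cons [leRHS](eq_integral (fun x => f i x + \sum_(j <- s) f j x)); last first.
  by move=> x _; rewrite big_cons.
apply: le_trans (ge0_le_integralD_nm _ _) => //.
  by rewrite leeD2l.
by move=> x; rewrite sume_ge0.
Qed.

End lower_integral.

(** * A [C^1] step function and its slope *)

Section cutoff.
Local Open Scope classical_set_scope.
Local Open Scope ring_scope.
Set Implicit Arguments.
Unset Strict Implicit.
Variable R : realType.
Implicit Types t : R.

(* [cutoff] is a C^1 step, 0 on [t <= 0] and 1 on [t >= 1], obtained by
   composing the C^1 function [sqpos] with itself. *)
Definition sqpos t : R := Num.max t 0 ^+ 2.

(** The first-order error is at most [|h|^2] for every position of [t] and [h + t] relative to 0, so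
    the junction point needs no separate argument. *)
Lemma is_derive_sqpos t : is_derive t 1 sqpos (2 * Num.max t 0).
Proof.
have bnd h : `|sqpos (h + t) - sqpos t - 2 * Num.max t 0 * h| <= `|h| ^+ 2.
  rewrite /sqpos -normrX (ger0_norm (sqr_ge0 h)) ler_norml.
  case: (leP (h + t) 0) => ht; case: (leP t 0) => t0; apply/andP; split; nra.
have L : (fun h => h^-1 *: (sqpos (h *: 1 + t) - sqpos t)) @ 0^' -->
    2 * Num.max t 0.
  apply/cvgrPdist_le => e e0; near=> h.
  have h0 : h != 0 by near: h; exact: nbhs_dnbhs_neq.
  have he : `|h| <= e by near: h; apply: dnbhs0_le.
  have -> : h *: (1 : R) = h by rewrite /GRing.scale/= mulr1.
  rewrite distrC -(ler_pM2l (_ : 0 < `|h|)) ?normr_gt0// -normrM.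
  have -> : h * (h^-1 *: (sqpos (h + t) - sqpos t) - 2 * Num.max t 0)
     = sqpos (h + t) - sqpos t - 2 * Num.max t 0 * h.
    by rewrite /GRing.scale/= mulrBr mulrA mulfV// mul1r (mulrC h).
  by apply: le_trans (bnd h) _; rewrite expr2 ler_wpM2l.
split; first by apply/cvg_ex; exists (2 * Num.max t 0).
exact/cvg_lim.
Unshelve. all: by end_near. Qed.

Definition cutoff t : R := 1 - sqpos (1 - sqpos t).

Definition dcutoff t : R := 2 * Num.max (1 - sqpos t) 0 * (2 * Num.max t 0).

Lemma is_derive_cutoff t : is_derive t 1 cutoff (dcutoff t).
Proof.
have d1 : is_derive t 1 (fun t : R => 1 - sqpos t) (- (2 * Num.max t 0)).
  by rewrite -[X in is_derive _ _ _ X]add0r; apply: is_deriveB; exact: is_derive_sqpos.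
have d2 : is_derive t 1 (sqpos \o (fun t : R => 1 - sqpos t))
   (2 * Num.max (1 - sqpos t) 0 * - (2 * Num.max t 0)).
  by apply: is_derive_comp; exact: is_derive_sqpos.
have -> : dcutoff t = 0 - (2 * Num.max (1 - sqpos t) 0 * - (2 * Num.max t 0)).
  by rewrite /dcutoff; lra.
by apply: is_deriveB; exact: d2.
Qed.

Lemma continuous_dcutoff : continuous dcutoff.
Proof.
have cm : continuous (fun t : R => Num.max t 0).
  move=> t; apply: continuous_max; first exact: cvg_id.
  exact: cvg_cst.
have cs : continuous sqpos.
  move=> t; apply/differentiable_continuous/derivable1_diffP.
  by have [] := is_derive_sqpos t.
move=> t; apply: cvgM; last first.
  by apply: cvgM; [exact: cvg_cst|exact: cm].
apply: cvgM; first exact: cvg_cst.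
apply: (@continuous_comp _ _ _ (fun t => 1 - sqpos t) (fun t : R => Num.max t 0)).
  by apply: cvgB; [exact: cvg_cst|exact: cs].
exact: cm.
Qed.

Lemma cutoff0 t : t <= 0 -> cutoff t = 0.
Proof. by move=> t0; rewrite /cutoff /sqpos (max_r t0) expr0n/= subr0 (max_l ler01) expr1n subrr. Qed.

Lemma cutoff1 t : 1 <= t -> cutoff t = 1.
Proof.
move=> t1; rewrite /cutoff /sqpos (max_l (le_trans ler01 t1)).
by rewrite max_r ?expr0n ?subr0//= subr_le0 exprn_ege1.
Qed.

Lemma cutoff_itv t : 0 <= cutoff t <= 1.
Proof.
rewrite /cutoff subr_ge0 lerBlDr lerDl exprn_ge0 ?le_max ?lexx ?orbT// andbT.
rewrite exprn_ile1 ?le_max ?lexx ?orbT// ge_max ler01 andbT.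
by rewrite gerBl exprn_ge0// le_max lexx orbT.
Qed.

Lemma dcutoff_out t : t <= 0 \/ 1 <= t -> dcutoff t = 0.
Proof.
rewrite /dcutoff; case=> [t0|t1]; first by rewrite (max_r t0) !mulr0.
rewrite /sqpos (max_l (le_trans ler01 t1)) max_r ?mulr0 ?mul0r//.
by rewrite subr_le0 exprn_ege1.
Qed.

Lemma dcutoff_bound t : dcutoff t ^+ 2 <= 4.
Proof.
have [t0|t0] := leP t 0; first by rewrite dcutoff_out ?expr0n//; left.
have [t1|t1] := leP 1 t; first by rewrite dcutoff_out ?expr0n//; right.
rewrite /dcutoff /sqpos (max_l (ltW t0)) max_l; last first.
  by rewrite subr_ge0 exprn_ile1// ltW.
have H0 : 0 <= 2 * (1 - t ^+ 2) * (2 * t).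
  by rewrite !mulr_ge0// ?subr_ge0 ?exprn_ile1// ltW.
have H2 : 2 * (1 - t ^+ 2) * (2 * t) <= 2.
  (* The claim is [2t - 2t^3 <= 1]. Adding the two inequalities with weights [2] and [14/5] leaves
     [0.18 t + 0.7 <= 1]. *)
  have := mulr_ge0 (ltW t0) (sqr_ge0 (t - 7 / 10)).
  have := sqr_ge0 (t - 1 / 2).
  nra.
rewrite -(_ : 2 ^+ 2 = 4 :> R); last by ring.
by rewrite ler_pXn2r// nnegrE.
Qed.

End cutoff.

(** * Hoelder's inequality for finite sums, and cutoffs between exponential levels *)

Section level_sums.
Local Open Scope classical_set_scope.
Local Open Scope ring_scope.
Set Implicit Arguments.
Unset Strict Implicit.

(** Induction on [s]; each step is the two-term inequality [hoelder2] with exponents [1/(1-q)] and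
    [1/q]. *)
Lemma hoelder_seq (R : realType) (I : Type) (s : seq I) (a b : I -> R) (q : R) :
  0 < q < 1 -> (forall i, 0 <= a i) -> (forall i, 0 <= b i) ->
  \sum_(i <- s) a i `^ (1 - q) * b i `^ q <=
    (\sum_(i <- s) a i) `^ (1 - q) * (\sum_(i <- s) b i) `^ q.
Proof.
move=> /andP[q0 q1] a0 b0; elim: s => [|i s ih].
  by rewrite !big_nil powR0 ?mul0r// subr_eq0 gt_eqF.
rewrite !big_cons; apply: le_trans (lerD (lexx _) ih) _.
set A := \sum_(j <- s) a j; set B := \sum_(j <- s) b j.
have A0 : 0 <= A by exact: sumr_ge0.
have B0 : 0 <= B by exact: sumr_ge0.
have q1' : 0 < 1 - q by rewrite subr_gt0.
have K (x r : R) : 0 < r -> 0 <= x -> (x `^ r) `^ r^-1 = x.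
  by move=> r0 x0; rewrite -powRrM mulfV ?gt_eqF// powRr1.
have := @hoelder2 R (a i `^ (1 - q)) (A `^ (1 - q)) (b i `^ q) (B `^ q)
  (1 - q)^-1 q^-1 (powR_ge0 _ _) (powR_ge0 _ _) (powR_ge0 _ _) (powR_ge0 _ _).
by rewrite !invr_gt0 !invrK !K// subrK; apply.
Qed.

Lemma ler_sum_single (R : numDomainType) (I : eqType) (s : seq I) (F : I -> R)
    (c : R) : uniq s -> 0 <= c -> (forall i, F i <= c) ->
  (forall i j, F i != 0 -> F j != 0 -> i = j) ->
  \sum_(i <- s) F i <= c.
Proof.
move=> us c0 Fc F1.
have [/hasP[i si Fi]|] := boolP (has (fun i => F i != 0) s).
  rewrite (bigD1_seq i)//= big1 ?addr0// => j ji.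
  by apply/eqP; apply: contraNT ji => Fj; rewrite (F1 _ _ Fj Fi).
by rewrite -all_predC => /allP H; rewrite big_seq big1// => i /H /=; rewrite negbK => /eqP.
Qed.

Variable R : realType.

(** Levels decrease in [j], so that superlevel sets increase with [j] as the sets [Omk] of the
    supremum must. *)
Definition rad (j : int) : R := expR (- j%:~R).

Lemma rad_gt0 j : 0 < rad j. Proof. exact: expR_gt0. Qed.

Lemma rad_le (i j : int) : i <= j -> rad j <= rad i.
Proof. by move=> ij; rewrite ler_expR lerN2 ler_int. Qed.

Lemma rad_gap j : rad j / 2 <= rad j - rad (j + 1).
Proof.
have -> : rad (j + 1) = rad j * expR (- 1).
  by rewrite /rad intrD opprD expRD.
have : expR (- 1) <= 1 / 2 :> R.
  rewrite expRN mul1r lef_pV2 ?posrE ?expR_gt0//.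
  by apply: le_trans (expR_ge1Dx 1); lra.
have := rad_gt0 j; nra.
Qed.

Definition level_cutoff j (t : R) : R :=
  cutoff ((t - rad (j + 1)) / (rad j - rad (j + 1))).

Definition dlevel_cutoff j (t : R) : R :=
  dcutoff ((t - rad (j + 1)) / (rad j - rad (j + 1))) / (rad j - rad (j + 1)).

Lemma rad_gap_gt0 j : 0 < rad j - rad (j + 1).
Proof. by apply: lt_le_trans (rad_gap j); rewrite divr_gt0 ?rad_gt0. Qed.

Lemma is_derive_level_cutoff j (t : R) :
  is_derive t 1 (level_cutoff j) (dlevel_cutoff j t).
Proof.
apply: (@is_derive_comp R R (fun t => (t - rad (j + 1)) / (rad j - rad (j + 1)))
  (@cutoff R)); last exact: is_derive_cutoff.
set c := (rad j - _).
rewrite (_ : (fun t => _) = (fun t => c^-1 *: (t - rad (j + 1)))); last first.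
  by apply/funext => u; rewrite mulrC.
rewrite [X in is_derive _ _ _ X](_ : _ = c^-1 *: (1 - 0 : R)); last first.
  by rewrite subr0 /GRing.scale/= mulr1.
have d : is_derive t 1 (fun t : R => t - rad (j + 1)) (1 - 0 : R).
  by apply: is_deriveB.
exact: (@is_deriveZ _ _ _ _ c^-1 t 1 _ d).
Qed.

Lemma continuous_dlevel_cutoff j : continuous (dlevel_cutoff j).
Proof.
move=> t; apply: cvgM; last exact: cvg_cst.
apply: (@continuous_comp _ _ _ (fun t => (t - rad (j + 1)) / _) (@dcutoff R)).
  apply: cvgM; last exact: cvg_cst.
  by apply: cvgB; [exact: cvg_id|exact: cvg_cst].
exact: continuous_dcutoff.
Qed.

Lemma level_cutoff_indic (T : Type) (w : T -> R) j (x : T) :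
  (\1_[set y | rad j < w y] x : R) <= level_cutoff j (w x) <=
    \1_[set y | rad (j + 1) < w y] x.
Proof.
have g0 := rad_gap_gt0 j.
have /andP[c0 c1] := cutoff_itv ((w x - rad (j + 1)) / (rad j - rad (j + 1))).
rewrite !indicE; apply/andP; split.
  have [/=|//] := boolP (x \in _); rewrite inE/= => xj.
  rewrite /level_cutoff cutoff1// ler_pdivlMr// mul1r lerD2r; exact: ltW.
have [//|] := boolP (x \in [set y | rad (j + 1) < w y]).
rewrite notin_setE/= => /negP; rewrite -leNgt => xj.
by rewrite /level_cutoff cutoff0// ler_pdivrMr// mul0r subr_le0.
Qed.

Lemma dlevel_cutoff_bound j t : rad j ^+ 2 * dlevel_cutoff j t ^+ 2 <= 16.
Proof.
rewrite /dlevel_cutoff; set d := dcutoff _; set g := rad j - _.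
have d4 : d ^+ 2 <= 4 by exact: dcutoff_bound.
have g0 : 0 < g := rad_gap_gt0 j.
have := rad_gap j; rewrite -/g ler_pdivrMr// => rg.
rewrite -exprMn mulrCA exprMn.
(* The [4] bounds the square of [dcutoff]; the [2] bounds [rad j / g], by [rad_gap]. *)
rewrite -(_ : 4 * 2 ^+ 2 = 16 :> R); last by ring.
apply: ler_pM => //; rewrite ?sqr_ge0//.
have rg0 : 0 <= rad j / g by rewrite divr_ge0// ltW// rad_gt0.
rewrite ler_pXn2r ?nnegrE//.
by rewrite ler_pdivrMr// mulrC.
Qed.

Lemma dlevel_cutoff_neq0 j t : dlevel_cutoff j t != 0 -> rad (j + 1) < t < rad j.
Proof.
have g0 := rad_gap_gt0 j.
apply: contraR; rewrite negb_and -!leNgt => H.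
rewrite /dlevel_cutoff dcutoff_out ?mul0r//.
case/orP: H => H; [left|right].
  by rewrite ler_pdivrMr// mul0r subr_le0.
by rewrite ler_pdivlMr// mul1r lerD2r.
Qed.

(** The derivatives live on the disjoint intervals between consecutive levels, so at most one term
    is nonzero. This is what lets the energies of all truncations share a single energy. *)
Lemma dlevel_cutoff_sum (s : seq int) t : uniq s ->
  \sum_(j <- s) rad j ^+ 2 / 16 * dlevel_cutoff j t ^+ 2 <= 1.
Proof.
move=> us; apply: ler_sum_single => // [j|i j].
  by rewrite mulrAC ler_pdivrMr// mul1r dlevel_cutoff_bound.
have H k : rad k ^+ 2 / 16 * dlevel_cutoff k t ^+ 2 != 0 -> rad (k + 1) < t < rad k.
  by move=> H; apply: dlevel_cutoff_neq0; apply: contraNneq H => ->; rewrite expr0n/= mulr0.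
move=> /H/andP[i1 i2] /H/andP[j1 j2].
apply/eqP; rewrite eq_le -!ltzD1; apply/andP; split; rewrite ltNge; apply/negP => /rad_le.
  by apply/negP; rewrite -ltNge (lt_trans j1).
by apply/negP; rewrite -ltNge (lt_trans i1).
Qed.

End level_sums.

(** * Capacities and the sum of [entlog] over superlevel sets *)

Section level_sums_on_manifold.
Local Open Scope classical_set_scope.
Local Open Scope ring_scope.
Local Open Scope ereal_scope.
Set Implicit Arguments.
Unset Strict Implicit.
Variables (R : realType) (n : nat) (M : riemannianManifold R n) (q : R).
Hypotheses (q_gt0 : (0 < q)%R) (q_lt1 : (q < 1)%R).
Variables (mu : probability (borel M) R) (nu : {measure set (borel M) -> \bar R}).

(** The supremum in [beta_LS] before the outer power [(1-q)/q], which is the quantity that Hoelder's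
    inequality produces. *)
Definition LS_sup : \bar R := ereal_sup [set s : \bar R |
     exists (Om : set (borel M)) (Omk : int -> set (borel M)),
     [/\ measurable Om,
         mu Om <= (1 / 2)%R%:E,
         forall k, measurable (Omk k),
         forall k, Omk k `<=` Omk (k + 1)%R /\ Omk (k + 1)%R `<=` Om &
         s = \esum_(k in [set: int]) LS_term q mu nu (Omk k) (Omk (k + 1)%R)]].

Definition entlog (x : R) : R := (x * ln (1 + expR 2 / x))%R.

Lemma entlog_ge0 (x : R) : (0 <= x)%R -> (0 <= entlog x)%R.
Proof.
move=> x0; rewrite mulr_ge0// ln_ge0// lerDl divr_ge0// ltW// expR_gt0//.
Qed.

Definition superlevel (w : M -> R) (r : R) : set (borel M) := [set x | (r < w x)%R].

Lemma measurable_superlevel w r : C1 w -> measurable (superlevel w r).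
Proof.
move=> wC; apply: sub_sigma_algebra.
rewrite (_ : superlevel w r = w @^-1` [set t | (r < t)%R])//.
apply: open_comp; last exact: open_gt.
by move=> x _; exact: C1_continuous.
Qed.

Lemma energy_ge0 (f : M -> R) : 0 <= energy nu f.
Proof. by apply: integral_ge0 => x _; rewrite lee_fin grad_normsq_ge0. Qed.

Lemma capacity_ge0 A B : 0 <= capacity nu A B.
Proof. by apply: le_ereal_inf_tmp => _ [f _ <-]; exact: energy_ge0. Qed.

Lemma LS_term_ge0 A B : 0 <= LS_term q mu nu A B.
Proof.
rewrite mule_ge0 ?inve_ge0 ?poweR_ge0// lee_fin powR_ge0//.
Qed.

(** The truncation [level_cutoff j \o w] is admissible for the capacity of layer [j], with energy
    density [dlevel_cutoff j (w x) ^+ 2 * grad_normsq w x]. Superadditivity puts the sum under the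
    integral, where [dlevel_cutoff_sum] applies pointwise. *)
Lemma capacity_sum (w : M -> R) (s : seq int) : C1 w -> uniq s ->
  \sum_(j <- s) (rad R j ^+ 2 / 16)%:E *
     capacity nu (superlevel w (rad R j)) (superlevel w (rad R (j + 1)))
    <= energy nu w.
Proof.
move=> wC us.
have H j := C1_comp wC (@is_derive_level_cutoff R j) (@continuous_dlevel_cutoff R j).
pose F j x := ((rad R j ^+ 2 / 16) * (dlevel_cutoff j (w x) ^+ 2 * grad_normsq w x))%:E.
have c0 j : (0 < rad R j ^+ 2 / 16)%R by rewrite divr_gt0// exprn_gt0// rad_gt0.
have F0 j x : 0 <= F j x.
  by rewrite lee_fin mulr_ge0 ?(ltW (c0 j))// mulr_ge0 ?sqr_ge0 ?grad_normsq_ge0.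
apply: (@le_trans _ _ (\sum_(j <- s) \int[nu]_x F j x)).
  apply: lee_sum => j _.
  apply: (@le_trans _ _ ((rad R j ^+ 2 / 16)%:E * energy nu (level_cutoff j \o w))).
    apply: lee_wpmul2l; first by rewrite lee_fin ltW.
    apply: ereal_inf_lbound; exists (level_cutoff j \o w) => //; split.
      by have [] := H j.
    by move=> x; exact: level_cutoff_indic.
  apply: le_trans (ge0_le_integralZl_nm _ (c0 j) _) _.
    by move=> x; rewrite lee_fin grad_normsq_ge0.
  apply: ge0_le_integral_nm => x.
    by rewrite mule_ge0// lee_fin ?grad_normsq_ge0 ?(ltW (c0 j)).
  by rewrite -EFinM; have [_ ->] := H j.
apply: le_trans (ge0_le_integral_sum_nm _ _ _) _ => //.
apply: ge0_le_integral_nm => x; first by rewrite sume_ge0.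
rewrite /F sumEFin lee_fin.
under eq_bigr do rewrite mulrA.
by rewrite -mulr_suml ler_piMl ?grad_normsq_ge0// dlevel_cutoff_sum.
Qed.

(** For positive capacity this is an identity: the exponents in [LS_term] are those for which
    [LS_term^(1-q) * capacity^q] is [entlog]. For zero capacity a finite term forces [entlog] to
    vanish. *)
Lemma LS_term_interpolation A B (r : R) : (0 < r)%R ->
  LS_term q mu nu A B < +oo -> capacity nu A B < +oo ->
  (r `^ (2 * q) * entlog (fine (mu A)) <=
    fine (LS_term q mu nu A B) `^ (1 - q) *
      (r ^+ 2 * fine (capacity nu A B)) `^ q)%R.
Proof.
move=> r0; rewrite /LS_term -/(entlog _).
have := entlog_ge0 (fine_ge0 (measure_ge0 mu A)).
set L := entlog _ => L0.
have := capacity_ge0 A B; case: (capacity nu A B) => [c|//|//].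
rewrite lee_fin le_eqVlt => /predU1P[<-|c0].
  rewrite poweR_EFin powR0; last by rewrite gt_eqF// divr_gt0// subr_gt0.
  rewrite inve0; have [L00|Ln0] := eqVneq L 0%R.
    by move=> *; rewrite L00 mulr0 mulr_ge0// powR_ge0.
  rewrite gt0_muley// lte_fin powR_gt0// lt_neqAle eq_sym Ln0//.
rewrite poweR_EFin inver gt_eqF ?powR_gt0// -EFinM => _ _ /=.
have q1 : (1 - q != 0)%R by rewrite gt_eqF// subr_gt0.
have E1 : ((L `^ (1 / (1 - q))) `^ (1 - q) = L)%R.
  by rewrite -powRrM mul1r mulVf// powRr1.
have E2 : ((c `^ (q / (1 - q)))^-1 `^ (1 - q) = (c `^ q)^-1)%R.
  by rewrite -powRN -powRrM mulNr -mulrA mulVf// mulr1 powRN.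
rewrite [X in (_ <= X * _)%R]powRM ?invr_ge0 ?powR_ge0// E1 E2.
rewrite powRM ?sqr_ge0 ?(ltW c0)// -(powR_mulrn _ (ltW r0)) -powRrM.
rewrite [leRHS](_ : _ = r `^ (2 * q) * L * (c `^ q / c `^ q))%R; last by ring.
by rewrite mulfV ?mulr1// gt_eqF// powR_gt0.
Qed.

(** The sets [{w > rad j}], inside [{w > 0}], are a competitor in [LS_sup]. Hoelder's inequality
    separates the interpolated terms into a sum bounded by [LS_sup] and one bounded by
    [capacity_sum]. *)
Lemma level_sum_le (w : M -> R) (s : seq int) : C1 w -> uniq s ->
  LS_sup < +oo -> energy nu w < +oo ->
  mu (superlevel w 0) <= (1 / 2)%R%:E ->
  (\sum_(j <- s) rad R j `^ (2 * q) * entlog (fine (mu (superlevel w (rad R j))))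
    <= fine LS_sup `^ (1 - q) * (16 * fine (energy nu w)) `^ q)%R.
Proof.
move=> wC us Sfin Efin w2.
pose Om j := superlevel w (rad R j).
pose T j := LS_term q mu nu (Om j) (Om (j + 1)%R).
pose c j := capacity nu (Om j) (Om (j + 1)%R).
have T0 j : 0 <= T j by exact: LS_term_ge0.
have c0 j : 0 <= c j by exact: capacity_ge0.
have sumT (l : seq int) : uniq l -> \sum_(j <- l) T j <= LS_sup.
  move=> ul; apply: (@le_trans _ _ (\esum_(k in [set: int]) T k)).
    apply: esum_ge; exists [set` l]; last by rewrite fsbig_seq.
    by split=> //; exact: finite_seq.
  apply: ereal_sup_ubound; exists (superlevel w 0), Om; split => //.
  - exact: measurable_superlevel.
  - by move=> k; exact: measurable_superlevel.
  - move=> k; split=> x.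
      by move=> xk; apply: le_lt_trans xk; apply: rad_le; rewrite lerDl.
    by move=> xk; apply: lt_trans xk; exact: rad_gt0.
have Tfin j : T j < +oo.
  by apply: le_lt_trans Sfin; have := sumT [:: j] isT; rewrite big_seq1.
(* An infinite capacity would make a single term of [capacity_sum], whose coefficient is positive,
   exceed the finite energy. *)
have cfin j : c j < +oo.
  have := @capacity_sum w [:: j] wC isT; rewrite big_seq1 => H.
  have := le_lt_trans H Efin; rewrite -[capacity _ _ _]/(c j).
  case: (c j) (c0 j) => [r _ _|_|//]; first by rewrite ltry.
  by rewrite gt0_muley// lte_fin divr_gt0// exprn_gt0// rad_gt0.
apply: (@le_trans _ _ (\sum_(j <- s) fine (T j) `^ (1 - q) *
    (rad R j ^+ 2 * fine (c j)) `^ q)%R).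
  by apply: ler_sum => j _; apply: (LS_term_interpolation (rad_gt0 R j) (Tfin j) (cfin j)).
apply: le_trans (hoelder_seq _ _ _ _) _.
- by rewrite q_gt0.
- by move=> j; rewrite fine_ge0.
- by move=> j; rewrite mulr_ge0 ?sqr_ge0 ?fine_ge0.
have TE : (\sum_(j <- s) T j = (\sum_(j <- s) fine (T j))%:E).
  by rewrite -sumEFin; apply: eq_bigr => j _; rewrite fineK// ge0_fin_numE.
apply: ler_pM; rewrite ?powR_ge0//.
  apply: ge0_ler_powR; rewrite ?nnegrE.
  - by rewrite subr_ge0 ltW.
  - by rewrite sumr_ge0// => j _; rewrite fine_ge0.
  - by rewrite fine_ge0// (le_trans _ (sumT [::] isT))// big_nil.
  - rewrite -lee_fin -TE fineK ?sumT// ge0_fin_numE//.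
    by rewrite (le_trans _ (sumT [::] isT))// big_nil.
apply: ge0_ler_powR; rewrite ?nnegrE.
- exact: ltW.
- by rewrite sumr_ge0// => j _; rewrite mulr_ge0 ?sqr_ge0 ?fine_ge0.
- by rewrite mulr_ge0// fine_ge0// energy_ge0.
- have := capacity_sum wC us.
  rewrite -[in X in _ <= X](@fineK _ (energy nu w)); last by rewrite ge0_fin_numE// energy_ge0.
  rewrite (eq_bigr (fun j => (rad R j ^+ 2 / 16 * fine (c j))%:E)); last first.
    by move=> j _; rewrite [RHS]EFinM fineK// ge0_fin_numE.
  rewrite sumEFin lee_fin -ler_pdivrMl// mulr_sumr; apply: le_trans.
  by apply: ler_sum => j _; rewrite mulrCA mulrA [X in (X * _)%R]mulrC.
Qed.

End level_sums_on_manifold.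

(** * The pointwise integrand of the variational formula *)

Section relative_entropy.
Local Open Scope ring_scope.
Set Implicit Arguments.
Unset Strict Implicit.
Variable R : realType.
Implicit Types g c : R.

Lemma ln_le_subr1 g : 0 < g -> ln g <= g - 1.
Proof.
move=> g0; have := @le_ln1Dx R (g - 1).
by rewrite (addrC 1) subrK; apply; rewrite ltrBrDr addNr.
Qed.

(** The Bregman divergence of [x ln x] from [c] to [g]; since [ln 0 = 0], its value at [g = 0] is
    [c]. *)
Definition kl_density c g : R := g * ln (g / c) - g + c.

Lemma kl_density_ge0 c g : 0 < c -> 0 <= g -> 0 <= kl_density c g.
Proof.
move=> c0; rewrite le_eqVlt /kl_density => /predU1P[<-|g0].
  by rewrite mul0r subrr add0r ltW.
have := ln_le_subr1 (divr_gt0 c0 g0); rewrite !ln_div// => H.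
have : g * (ln c - ln g) <= g * (c / g - 1) by rewrite ler_wpM2l// ltW.
have -> : g * (c / g - 1) = c - g by field; rewrite gt_eqF.
lra.
Qed.

Lemma kl_density_change c d g : 0 < c -> 0 < d -> 0 <= g ->
  kl_density d g = kl_density c g + ln (c / d) * g + (d - c).
Proof.
move=> c0 d0; rewrite le_eqVlt /kl_density => /predU1P[<-|g0].
  by rewrite !mul0r mulr0; lra.
by rewrite !ln_div//; lra.
Qed.

(** Nonnegativity of [kl_density] at the reference point [e c], where the change of reference
    contributes exactly [- g]. It yields integrability of [g]. *)
Lemma le_kl_density c g : 0 < c -> 0 <= g ->
  g <= kl_density c g + expR 1 * c.
Proof.
move=> c0 g0; have ec0 : 0 < expR 1 * c by rewrite mulr_gt0// expR_gt0.
have := kl_density_ge0 ec0 g0.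
rewrite (kl_density_change c0 ec0 g0) ln_div// lnM// ?posrE ?expR_gt0// expRK.
lra.
Qed.

(** Enlarging the reference lowers the logarithm, and [ln x <= x - 1] then turns the divergence into
    a chi-square term. *)
Lemma kl_density_le_sqr c b g : 0 < c -> 0 <= b -> 0 <= g ->
  kl_density (c + b) g <= b + c * (g / c - 1) ^+ 2.
Proof.
move=> c0 b0; rewrite le_eqVlt /kl_density => /predU1P[<-|g0].
  by rewrite !mul0r subrr; lra.
have cb0 : 0 < c + b by rewrite ltr_wpDr.
have H1 : ln (g / (c + b)) <= ln (g / c).
  by rewrite !ln_div// lerD2l lerN2 ler_ln// lerDl.
have H2 := ln_le_subr1 (divr_gt0 g0 c0).
have H3 : g * ln (g / (c + b)) <= g * (g / c - 1).
  by rewrite ler_wpM2l ?(ltW g0)// (le_trans H1).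
have -> : c * (g / c - 1) ^+ 2 = g * (g / c - 1) - g + c.
  by field; rewrite gt_eqF.
lra.
Qed.

End relative_entropy.

(** * The variational bound on the entropy *)

Section entropy_bound.
Local Open Scope ereal_scope.
Set Implicit Arguments.
Unset Strict Implicit.
Variables (R : realType) (T : ptopologicalType) (mu : probability (borel T) R).

(* [c |-> \int kl_density c g] is minimal at the mean of [g], where it is the
   entropy. *)
Lemma entropy_le (g : borel T -> R) (c X : R) :
  measurable_fun setT g -> (forall x, (0 <= g x)%R) -> (0 < c)%R ->
  \int[mu]_x (kl_density c (g x))%:E <= X%:E ->
  0 <= entropy mu g <= X%:E.
Proof.
move=> mg g0 c0 HX.
have mH d : measurable_fun setT (fun x => kl_density d (g x)).
  apply: measurable_funD; last exact: measurable_cst.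
  apply: measurable_funB => //; apply: measurable_funM => //.
  apply: measurableT_comp; first exact: measurable_ln.
  by apply: measurable_funM => //; exact: measurable_cst.
have H0 x : (0 <= kl_density c (g x))%R by exact: kl_density_ge0.
have iH : mu.-integrable setT (EFin \o (fun x => kl_density c (g x))).
  apply/integrableP; split; first exact/measurable_EFinP.
  apply: le_lt_trans (ltry X); apply: le_trans HX.
  by rewrite le_eqVlt; apply/orP; left; apply/eqP/eq_integral => x _ /=; rewrite ger0_norm.
have ic k : mu.-integrable setT (EFin \o cst k).
  exact: finite_measure_integrable_cst.
have ig : mu.-integrable setT (EFin \o g).
  apply: (@le_integrable _ _ _ mu _ measurableT _
    ((EFin \o (fun x => kl_density c (g x))) \+ (EFin \o cst (expR 1 * c)%R))).
  - exact/measurable_EFinP.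
  - move=> x _ /=; rewrite lee_fin ger0_norm// (le_trans _ (ler_norm _))//.
    exact: le_kl_density.
  - exact: integrableD.
have aff (a b : R) : \int[mu]_x (kl_density c (g x) + a * g x + b)%:E =
    \int[mu]_x (kl_density c (g x))%:E + a%:E * \int[mu]_x (g x)%:E + b%:E.
  have iag : mu.-integrable setT (fun x => a%:E * (g x)%:E) by exact: integrableZl.
  under eq_integral do rewrite !EFinD EFinM.
  rewrite integralD//; [|by apply: integrableD|exact: (ic b)].
  have Z : \int[mu]_x (a%:E * (g x)%:E) = a%:E * \int[mu]_x (g x)%:E.
    exact: (integralZl measurableT ig).
  rewrite integralD// Z.
  have -> : \int[mu]_x b%:E = b%:E.
    apply: etrans (integral_cst mu measurableT b%:E) _.
    by rewrite [X in _ * X](_ : _ = 1) ?mule1//; exact: probability_setT.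
  by [].
set m := \int[mu]_x (g x)%:E.
have m0 : 0 <= m by apply: integral_ge0 => x _; rewrite lee_fin.
have mfin : m \is a fin_num by rewrite ge0_fin_numE// integrable_lty.
have X0 : 0 <= X%:E by apply: le_trans HX; apply: integral_ge0 => x _; rewrite lee_fin.
rewrite /entropy -/m.
rewrite ifF; last by apply/negbTE; rewrite -ltey -ge0_fin_numE.
(* With mean 0 the integrand is 0 everywhere, by [x / 0 = 0] and [ln 0 = 0]. *)
have [M0|Mn0] := eqVneq (fine m) 0%R.
  rewrite (eq_integral (cst 0)) ?integral0 ?lexx//.
  by move=> x _; rewrite M0 invr0 mulr0 ln0// mulr0.
have Mgt0 : (0 < fine m)%R by rewrite lt_neqAle eq_sym Mn0 fine_ge0.
(* [E1] shows that the entropy is the given integral minus [kl_density c (fine m)], hence the upper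
   bound; the right-hand side of [E2] has the same value, hence nonnegativity. *)
have E1 : \int[mu]_x (g x * ln (g x / fine m))%R%:E =
  \int[mu]_x (kl_density c (g x))%:E + (ln (c / fine m) + 1)%R%:E * m + (- c)%R%:E.
  rewrite -aff; apply: eq_integral => x _; congr (_%:E).
  by have := kl_density_change c0 Mgt0 (g0 x); rewrite {1}/kl_density; lra.
have E2 : \int[mu]_x (kl_density (fine m) (g x))%:E =
  \int[mu]_x (kl_density c (g x))%:E + (ln (c / fine m))%:E * m + (fine m - c)%:E.
  rewrite -aff; apply: eq_integral => x _; congr (_%:E).
  exact: kl_density_change.
have : 0 <= \int[mu]_x (kl_density (fine m) (g x))%:E.
  by apply: integral_ge0 => x _; rewrite lee_fin kl_density_ge0.
rewrite E1 E2.
have := kl_density_ge0 c0 (fine_ge0 m0).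
have -> : m = (fine m)%:E by rewrite fineK.
have : \int[mu]_x (kl_density c (g x))%:E \is a fin_num.
  by rewrite ge0_fin_numE ?integrable_lty// integral_ge0// => x _; rewrite lee_fin.
case: (\int[mu]_x (kl_density c (g x))%:E) HX => [h|//|//] HX _ /=.
rewrite -!EFinM -!EFinD !lee_fin.
rewrite /kl_density !ln_div ?posrE// => K1 K2.
move: HX; rewrite lee_fin => HX; apply/andP; split; lra.
Qed.

End entropy_bound.

(** * Pointwise bounds of the entropy integrand on a layer *)

Section layer_weights.
Local Open Scope ring_scope.
Set Implicit Arguments.
Unset Strict Implicit.
Variables (R : realType) (p : R).
Hypotheses (p_gt0 : 0 < p) (p_lt2 : p < 2).

(** As [0 < p < 2], [x^p] lies between [1] and [x^2], so [|x^p - 1| <= 3 |x - 1|] on [[0, 2]]; and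
    [|x - 1| <= 1] allows the exponent 2 to be lowered to [p]. *)
Lemma sqr_powR_sub1_le (x : R) : 0 <= x <= 2 -> 
  (x `^ p - 1) ^+ 2 <= 9 * `|x - 1| `^ p.
Proof.
move=> /andP[x0 x2].
have y1 : `|x - 1| <= 1 by rewrite ler_norml; lra.
have H : `|x `^ p - 1| <= 3 * `|x - 1|.
  have [x1|x1] := leP 1 x.
    have H1 : 1 <= x `^ p by rewrite -(powRr0 x) ler_powR// ltW.
    have H2 : x `^ p <= x ^+ 2 by rewrite -powR_mulrn// ler_powR// ltW.
    rewrite !ger0_norm ?subr_ge0//; nra.
  have [->|xn0] := eqVneq x 0.
    by rewrite powR0 ?gt_eqF// !sub0r normrN normr1; lra.
  have xgt0 : 0 < x by rewrite lt_neqAle eq_sym xn0.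
  have xi : 0 < x <= 1 by rewrite xgt0 ltW.
  have H1 : x `^ p <= 1 by rewrite -(powRr0 x) ger_powR// ltW.
  have H2 : x ^+ 2 <= x `^ p by rewrite -powR_mulrn// ger_powR// ltW.
  rewrite -normrN opprB -[`|x - 1|]normrN opprB.
  rewrite !ger0_norm ?subr_ge0// ?ltW//; nra.
rewrite -real_normK ?num_real//; set y := `|x - 1| in y1 H *.
apply: (@le_trans _ _ (9 * y ^+ 2)).
  rewrite -(_ : 3 ^+ 2 = 9 :> R); last by ring.
  by rewrite -exprMn ler_pXn2r// nnegrE ?mulr_ge0// normr_ge0.
rewrite ler_wpM2l//.
have [->|yn0] := eqVneq y 0; first by rewrite expr0n/= powR_ge0.
have y0 : 0 < y by rewrite lt_neqAle eq_sym yn0 normr_ge0.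
by rewrite -powR_mulrn ?(ltW y0)// ger_powR ?y0// ltW.
Qed.

(* Dominates the entropy integrand on the layer [r < |f - m| <= e r]; the
   logarithm is taken of [r^p / B] rather than of the measure of the layer so
   that the bound is pointwise everywhere, layers of measure 0 included. *)
Definition layer_weight (B r : R) : R :=
  9 * expR 2 * r `^ p * (2 + Num.max 0 (ln (r `^ p / B))).

Lemma layer_weight_ge B r : 0 < r ->
  9 * expR 2 * r `^ p <= layer_weight B r.
Proof.
move=> r0; rewrite ler_pMr ?mulr_gt0 ?expR_gt0 ?powR_gt0//.
have : 0 <= Num.max 0 (ln (r `^ p / B)) by rewrite le_max lexx.
lra.
Qed.

Lemma layer_weight_ge0 B r : 0 <= layer_weight B r.
Proof.
rewrite !mulr_ge0 ?expR_ge0 ?powR_ge0// addr_ge0// le_max lexx//.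
Qed.

Lemma powR_layer (r u : R) : 0 < r -> 0 <= u -> u <= expR 1 * r ->
  u `^ p <= expR 2 * r `^ p.
Proof.
move=> r0 u0 ur.
apply: (@le_trans _ _ ((expR 1 * r) `^ p)).
  by apply: ge0_ler_powR => //; rewrite ?nnegrE ?mulr_ge0 ?expR_ge0 ?(ltW r0) ?(ltW p_gt0).
rewrite powRM ?expR_ge0 ?(ltW r0)//.
rewrite ler_wpM2r ?powR_ge0// /powR gt_eqF ?expR_gt0// expRK mulr1 ler_expR.
exact: ltW.
Qed.

(** For [f <= 2m] the chi-square bound is of order [|f - m|^p]. For [f > 2m] both [m] and [f] are
    controlled by [f - m], and the [B] in the reference keeps the logarithm below
    [4 + max(0, ln (r^p / B))]. *)
Lemma kl_density_layer (m f B r : R) : 0 <= m -> 0 <= f -> 0 < B -> 0 < r ->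
  `|f - m| <= expR 1 * r ->
  kl_density (m `^ p + B) (f `^ p) <= B + layer_weight B r.
Proof.
move=> m0 f0 B0 r0 ur.
have uP := powR_layer r0 (normr_ge0 _) ur.
have [fm|fm] := leP f (2 * m).
  have [mE|mn0] := eqVneq m 0.
    move: fm; rewrite mE mulr0 => fm; have -> : f = 0 by lra.
    rewrite powR0 ?gt_eqF// add0r /kl_density mul0r sub0r oppr0 add0r.
    by rewrite lerDl layer_weight_ge0.
  have mgt0 : 0 < m by rewrite lt_neqAle eq_sym mn0.
  have c0 : 0 < m `^ p by rewrite powR_gt0.
  apply: le_trans (kl_density_le_sqr c0 (ltW B0) (powR_ge0 _ _)) _.
  rewrite lerD2l; apply: le_trans (layer_weight_ge B r0).
  have fE : f = m * (f / m) by field.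
  have fm0 : 0 <= f / m by rewrite divr_ge0.
  have -> : f `^ p / m `^ p = (f / m) `^ p.
    by rewrite {1}fE powRM// mulrAC mulfV ?mul1r// gt_eqF.
  apply: (@le_trans _ _ (m `^ p * (9 * `|f / m - 1| `^ p))).
    rewrite ler_wpM2l ?powR_ge0// sqr_powR_sub1_le// fm0 ler_pdivrMr//.
  rewrite mulrCA -powRM// -[X in X * `|_|](ger0_norm m0) -normrM.
  have -> : m * (f / m - 1) = f - m by field.
  by rewrite -mulrA ler_wpM2l.
have mf : m < f by lra.
rewrite ger0_norm ?subr_ge0 ?(ltW mf)// in uP ur *.
set u := f - m in uP ur *.
have um : m <= u by rewrite /u; lra.
have fu : f <= 2 * u by rewrite /u; lra.
have u0 : 0 <= u by lra.
have fgt0 : 0 < f by lra.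
have g0 : 0 < f `^ p by rewrite powR_gt0.
have g4 : f `^ p <= 4 * u `^ p.
  apply: (@le_trans _ _ ((2 * u) `^ p)).
    by apply: ge0_ler_powR; rewrite ?nnegrE// ?mulr_ge0// ltW.
  rewrite powRM// ler_wpM2r ?powR_ge0//.
  rewrite -(_ : 2 ^+ 2 = 4 :> R); last by ring.
  by rewrite -powR_mulrn// ler_powR// ?ltW//; lra.
have mu : m `^ p <= u `^ p.
  by apply: ge0_ler_powR; rewrite ?nnegrE// ltW.
have e4 : 4 <= expR 2 :> R.
  have -> : 2 = 1 + 1 :> R by lra.
  have H := expR_ge1Dx (1 : R); rewrite expRD; nra.
set X := Num.max 0 (ln (r `^ p / B)).
have X0 : 0 <= X by rewrite le_max lexx.
have lnX : ln (r `^ p / B) <= X by rewrite le_max lexx orbT.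
have rp0 : 0 < r `^ p by rewrite powR_gt0.
have H1 : ln (f `^ p / (m `^ p + B)) <= 4 + X.
  apply: (@le_trans _ _ (ln (expR 2 * expR 2 * (r `^ p / B)))); last first.
    rewrite !lnM ?posrE ?mulr_gt0 ?expR_gt0 ?invr_gt0// expRK.
    by move: lnX; rewrite lnM ?posrE ?invr_gt0//; lra.
  have mB0 : 0 < m `^ p + B by rewrite ltr_wpDl ?powR_ge0.
  rewrite ler_ln ?posrE ?divr_gt0 ?mulr_gt0 ?expR_gt0 ?invr_gt0//.
  rewrite mulrA; apply: ler_pM.
  - exact: ltW.
  - by rewrite invr_ge0 ltW.
  - apply: (le_trans g4); rewrite -mulrA; apply: ler_pM => //.
    by rewrite powR_ge0.
  - by rewrite lef_pV2 ?posrE// lerDr powR_ge0.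
have H2 : f `^ p * ln (f `^ p / (m `^ p + B)) <= 4 * u `^ p * (4 + X).
  apply: (@le_trans _ _ (f `^ p * (4 + X))); last first.
    by rewrite ler_wpM2r// addr_ge0.
  by apply: ler_wpM2l => //; exact: ltW.
rewrite /kl_density /layer_weight -/X.
(* [17 + 4 X] is [4 (4 + X)] plus [1] from [m^p <= u^p]; [H5] is the slack up to the [9 (2 + X)] of
   [layer_weight]. *)
have H3 : u `^ p * (17 + 4 * X) <= expR 2 * r `^ p * (17 + 4 * X).
  by rewrite ler_wpM2r// addr_ge0// mulr_ge0.
have H4 : 0 <= expR 2 * r `^ p by rewrite mulr_ge0 ?expR_ge0 ?(ltW rp0).
have H5 : 0 <= expR 2 * r `^ p * (1 + 5 * X) by rewrite mulr_ge0// addr_ge0// mulr_ge0.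
lra.
Qed.

(** The logarithm in [entlog] is at least [2 - ln x >= 2], so the single-term hypothesis gives
    [r^p / B <= 1/x]. Hence the bracket in [layer_weight] is at most [ln (e^2 / x)]: the [e^2]
    supplies the summand 2. *)
Lemma layer_weight_entlog (B r x : R) : 0 < B -> 0 < r -> 0 <= x <= 1 ->
  r `^ p * entlog x <= B ->
  layer_weight B r * x <= 9 * expR 2 * (r `^ p * entlog x).
Proof.
move=> B0 r0 /andP[]; rewrite le_eqVlt /entlog => /predU1P[<-|x0] x1 H.
  by rewrite mulr0 mul0r !mulr0.
have rp0 : 0 < r `^ p by rewrite powR_gt0.
set L := ln (1 + expR 2 / x) in H *.
have L1 : ln (expR 2 / x) <= L.
  by rewrite ler_ln ?posrE ?addr_gt0 ?divr_gt0 ?expR_gt0// lerDr.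
have lx : ln (expR 2 / x) = 2 - ln x by rewrite ln_div ?posrE ?expR_gt0// expRK.
have lx0 : ln x <= 0 by rewrite ln_le0.
have L2 : 2 <= L by lra.
have L3 : 2 + ln (r `^ p / B) <= L.
  apply: le_trans L1; rewrite lx lerD2l.
  have : r `^ p / B <= x^-1.
    rewrite ler_pdivrMr// mulrC ler_pdivlMr//.
    apply: le_trans H; rewrite mulrA ler_pMr ?mulr_gt0//; lra.
  rewrite -lnV// ler_ln ?posrE ?divr_gt0 ?invr_gt0//.
rewrite /layer_weight [leRHS](_ : _ = 9 * expR 2 * r `^ p * L * x); last by ring.
rewrite ler_wpM2r ?(ltW x0)// ler_wpM2l ?mulr_ge0 ?expR_ge0 ?(ltW rp0)//.
by rewrite -lerBrDl ge_max; apply/andP; split; lra.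
Qed.

End layer_weights.

(** * Integration over all layers *)

Section layer_integral.
Local Open Scope classical_set_scope.
Local Open Scope ring_scope.
Local Open Scope ereal_scope.
Set Implicit Arguments.
Unset Strict Implicit.

(** A bijection from the naturals to the integers, so that the layers form a series that can be
    integrated term by term. *)
Definition int_enum (n : nat) : int := if odd n then Negz n./2 else Posz n./2.

Lemma int_enum_inj : injective int_enum.
Proof.
move=> i j ij; suff [oij hij] : odd i = odd j /\ i./2 = j./2.
  by rewrite -(odd_double_half i) oij hij odd_double_half.
by move: ij; rewrite /int_enum; case: odd; case: odd => // -[->].
Qed.

Lemma int_enum_surj k : exists n, int_enum n = k.
Proof.
case: k => k; [exists k.*2|exists k.*2.+1]; rewrite /int_enum.
  by rewrite odd_double doubleK.
by rewrite /= odd_double/= uphalf_double.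
Qed.

Lemma rad_layer (R : realType) (u : R) : (0 < u)%R ->
  exists k, (rad R (int_enum k) < u <= expR 1 * rad R (int_enum k))%R.
Proof.
(* With [j = floor (- ln u)] one has [j <= - ln u < j + 1]; the shift by one makes the lower level
   strictly smaller than [u]. *)
move=> u0; have [k kE] := int_enum_surj (Num.floor (- ln u) + 1)%R.
exists k; rewrite kE /rad; set j := Num.floor _.
have /andP[] := floor_itv (- ln u).
rewrite -/j intrD => j2 j1; rewrite -expRD -{1 2}[u]lnK ?posrE//.
by rewrite ltr_expR ler_expR; apply/andP; split; lra.
Qed.

Context d (T : measurableType d) (R : realType) (mu : probability T R) (p : R).
Hypotheses (p_gt0 : (0 < p)%R) (p_lt2 : (p < 2)%R).

Let level_set (w : T -> R) (n : nat) : set T := [set x | (rad R (int_enum n) < w x)%R].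

(** Each weight is put on the whole superlevel set rather than on the layer alone: weights are
    nonnegative, so this only overcounts, and the measures that appear are those in
    [entlog_sum_bounded]. *)
Let layers (B : R) (w : T -> R) (n : nat) (x : T) : \bar R :=
  (layer_weight p B (rad R (int_enum n)))%:E * (\1_(level_set w n) x)%:E.

Let measurable_level_set w n : measurable_fun setT w -> measurable (level_set w n).
Proof.
move=> mw; rewrite -[level_set _ _]setTI (_ : level_set w n = w @^-1` `]rad R (int_enum n), +oo[).
  exact: mw.
by apply/seteqP; split => x; rewrite /level_set /= in_itv/= andbT.
Qed.

Let layers_ge0 B w n x : 0 <= layers B w n x.
Proof. by rewrite mule_ge0// lee_fin layer_weight_ge0. Qed.

Let measurable_layers B w n : measurable_fun setT w -> measurable_fun setT (layers B w n).
Proof.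
move=> mw; apply: measurable_funeM; apply/measurable_EFinP.
apply: measurable_indic; exact: measurable_level_set.
Qed.

Let layers_lower B w x : (0 < w x)%R ->
  exists2 r : R, (0 < r)%R /\ (w x <= expR 1 * r)%R &
  (layer_weight p B r)%:E <= \sum_(0 <= n <oo) layers B w n x.
Proof.
move=> /rad_layer[k /andP[k1 k2]]; exists (rad R (int_enum k)).
  by split=> //; exact: rad_gt0.
apply: le_trans (nneseries_lim_ge k.+1 _); last by move=> n _ _; exact: layers_ge0.
rewrite big_nat_recr//=.
have -> : layers B w k x = (layer_weight p B (rad R (int_enum k)))%:E.
  by rewrite /layers indicE mem_set ?mule1.
by apply: leeDr; apply: sume_ge0 => n _; exact: layers_ge0.
Qed.

Let entlog_sum_bounded (w : T -> R) (B : R) := forall s : seq int, uniq s ->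
  (\sum_(j <- s) rad R j `^ p * entlog (fine (mu [set x | (rad R j < w x)%R])) <= B)%R.

(** [HB] enters twice: on singletons, as the hypothesis of [layer_weight_entlog], and on images of
    initial segments, to bound the partial sums. *)
Let integral_layers B w : (0 < B)%R -> measurable_fun setT w ->
  entlog_sum_bounded w B ->
  \int[mu]_x (\sum_(0 <= n <oo) layers B w n x) <= (9 * expR 2 * B)%:E.
Proof.
move=> B0 mw HB.
rewrite integral_nneseries//; last by move=> n; exact: measurable_layers.
apply: lime_le.
  by apply: is_cvg_nneseries => n _ _; apply: integral_ge0 => x _; exact: layers_ge0.
apply: nearW => N.
apply: (@le_trans _ _ (\sum_(0 <= n < N)
  (9 * expR 2 * (rad R (int_enum n) `^ p * entlog (fine (mu (level_set w n)))))%:E)); last first.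
  rewrite sumEFin lee_fin -mulr_sumr ler_wpM2l ?mulr_ge0 ?expR_ge0//.
  have := HB (map int_enum (index_iota 0 N)).
  rewrite map_inj_uniq ?iota_uniq; last exact: int_enum_inj.
  by rewrite big_map; apply.
apply: lee_sum => n _.
have mls := measurable_level_set n mw.
rewrite ge0_integralZl_EFin//; last 2 first.
- by apply/measurable_EFinP; exact: measurable_indic.
- exact: layer_weight_ge0.
rewrite integral_indic// setIT.
have mf : mu (level_set w n) \is a fin_num by exact: fin_num_measure.
rewrite -[X in _ * X](fineK mf) -EFinM lee_fin.
apply: layer_weight_entlog => //; first exact: rad_gt0.
  by rewrite fine_ge0//= -lee_fin fineK// probability_le1.
by have := HB [:: int_enum n] isT; rewrite big_seq1.
Qed.

Lemma integral_kl_density_le (f : T -> R) (m B : R) :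
  measurable_fun setT f -> (forall x, (0 <= f x)%R) -> (0 <= m)%R -> (0 < B)%R ->
  entlog_sum_bounded (fun x => f x - m)%R B ->
  entlog_sum_bounded (fun x => m - f x)%R B ->
  \int[mu]_x (kl_density (m `^ p + B) (f x `^ p))%:E <= ((1 + 18 * expR 2) * B)%:E.
Proof.
move=> mf f0 m0 B0 Hu Hl.
pose wu x := (f x - m)%R; pose wl x := (m - f x)%R.
have mu_ : measurable_fun setT wu by apply: measurable_funB => //; exact: measurable_cst.
have ml_ : measurable_fun setT wl by apply: measurable_funB => //; exact: measurable_cst.
pose S w x := \sum_(0 <= n <oo) layers B w n x.
have S0 w x : 0 <= S w x by apply: nneseries_ge0 => n _ _; exact: layers_ge0.
have mS w : measurable_fun setT w -> measurable_fun setT (S w).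
  move=> mw; apply: ge0_emeasurable_sum => [n x _ _|n _]; first exact: layers_ge0.
  exact: measurable_layers.
have c0 : (0 < m `^ p + B)%R by rewrite ltr_wpDl ?powR_ge0.
apply: (@le_trans _ _ (\int[mu]_x (B%:E + (S wu x + S wl x)))).
  apply: ge0_le_integral_nm => x.
    by rewrite lee_fin kl_density_ge0// powR_ge0.
  have [xm|xm|xm] := ltgtP (f x) m.
  - have wx : (0 < wl x)%R by rewrite subr_gt0.
    have [r [r0 rx] H] := layers_lower B wx.
    apply: (@le_trans _ _ (B + layer_weight p B r)%:E).
      rewrite lee_fin; apply: kl_density_layer => //.
      by rewrite distrC ger0_norm ?(ltW wx).
    by rewrite EFinD leeD2l// (le_trans H)// leeDr.
  - have wx : (0 < wu x)%R by rewrite subr_gt0.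
    have [r [r0 rx] H] := layers_lower B wx.
    apply: (@le_trans _ _ (B + layer_weight p B r)%:E).
      rewrite lee_fin; apply: kl_density_layer => //.
      by rewrite ger0_norm ?(ltW wx).
    by rewrite EFinD leeD2l// (le_trans H)// leeDl.
  (* At [f x = m] no layer contains [x], but the logarithm is nonpositive and only [B] remains. *)
  - apply: (@le_trans _ _ B%:E); last by rewrite leeDl// adde_ge0.
    rewrite lee_fin xm /kl_density.
    have := powR_ge0 m p; rewrite le_eqVlt => /predU1P[<-|mp0].
      by rewrite mul0r; lra.
    have : (ln (m `^ p / (m `^ p + B)) <= 0)%R.
      by apply: ln_le0; rewrite ler_pdivrMr// mul1r lerDl ltW.
    nra.
rewrite ge0_integralD//; last 3 first.
- by move=> x _; rewrite lee_fin ltW.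
- by move=> x _; rewrite adde_ge0.
- by apply: emeasurable_funD; exact: mS.
rewrite ge0_integralD//; [|exact: mS|exact: mS].
have -> : \int[mu]_x B%:E = B%:E.
  apply: etrans (integral_cst mu measurableT B%:E) _.
  by rewrite [X in _ * X](_ : _ = 1) ?mule1//; exact: probability_setT.
(* One [B] from the constant under a probability, and [9 e^2 B] for each side of [m]. *)
have -> : ((1 + 18 * expR 2) * B = B + (9 * expR 2 * B + 9 * expR 2 * B))%R by ring.
by rewrite 2!EFinD leeD2l// leeD// integral_layers.
Qed.

End layer_integral.

(** * Existence of a median *)

Section median.
Local Open Scope classical_set_scope.
Local Open Scope ring_scope.
Local Open Scope ereal_scope.
Set Implicit Arguments.
Unset Strict Implicit.
Context d (T : measurableType d) (R : realType) (mu : probability T R).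

Lemma measure_bigcup_nondecreasing_le (F : (set T)^nat) (c : \bar R) :
  (forall i, measurable (F i)) -> {homo F : i j / (i <= j)%N >-> (i <= j)%O} ->
  (forall i, mu (F i) <= c) -> mu (\bigcup_n F n) <= c.
Proof.
move=> mF ndF Fc.
have mUF : measurable (\bigcup_n F n) by exact: bigcupT_measurable.
have cF : mu \o F @ \oo --> mu (\bigcup_n F n) by exact: nondecreasing_cvg_mu.
rewrite -(cvg_lim _ cF)//; apply: lime_le; first by apply/cvg_ex; eexists; exact: cF.
exact: nearW.
Qed.

(** [m] is the infimum of the levels [t >= 0] with [mu {f > t} <= 1/2]; the strict sets above and
    below [m] are increasing unions of sets at levels [m + 1/n] and [m - 1/n]. *)
Lemma median_ge0 (f : T -> R) : measurable_fun setT f -> (forall x, (0 <= f x)%R) ->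
  exists m : R, [/\ (0 <= m)%R, mu [set x | (m < f x)%R] <= (1 / 2)%:E &
    mu [set x | (f x < m)%R] <= (1 / 2)%:E].
Proof.
move=> mf f0.
have mle t : measurable [set x | (f x <= t)%R].
  rewrite -[X in measurable X]setTI (_ : [set x | _] = f @^-1` `]-oo, t]); first exact: mf.
  by apply/seteqP; split => x; rewrite /= in_itv.
have gtC t : [set x | (t < f x)%R] = ~` [set x | (f x <= t)%R].
  by apply/seteqP; split => x /=; rewrite ltNge => /negP.
have mgt t : measurable [set x | (t < f x)%R] by rewrite gtC; exact: measurableC.
have mono s t : (s <= t)%R -> mu [set x | (t < f x)%R] <= mu [set x | (s < f x)%R].
  move=> st; apply: le_measure; rewrite ?inE//.
  by move=> x /=; exact: le_lt_trans.
have half t : (mu [set x | (t < f x)%R] <= (1 / 2)%:E) = ((1 / 2)%:E <= mu [set x | (f x <= t)%R]).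
  rewrite gtC probability_setC//.
  have : mu [set x | (f x <= t)%R] \is a fin_num by exact: fin_num_measure.
  case: (mu _) => // r _; rewrite -EFinB !lee_fin.
  by apply/idP/idP => ?; lra.
pose S := [set t : R | (0 <= t)%R /\ mu [set x | (t < f x)%R] <= (1 / 2)%:E].
have S0 : S !=set0.
  (* Otherwise every [{f <= n}] has measure at most 1/2, although these sets exhaust the space. *)
  apply/not_existsP => nS.
  have : mu (\bigcup_n [set x | (f x <= n%:R)%R]) <= (1 / 2)%:E.
    apply: measure_bigcup_nondecreasing_le => [//|i j ij|i].
      by apply/subsetPset => x /= /le_trans; apply; rewrite ler_nat.
    rewrite leNgt; apply/negP => /ltW H; apply: (nS i%:R); split => //.
    by rewrite half.
  rewrite (_ : \bigcup_n _ = setT); last first.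
    apply/seteqP; split => // x _; exists (Num.bound (f x)) => //=.
    by apply/ltW; have := archi_boundP (f0 x).
  by rewrite probability_setT lee_fin; lra.
have hS : has_inf S by split => //; exists 0%R => t [].
pose m := inf S.
have m0 : (0 <= m)%R by apply: lb_le_inf => // t [].
have inv0 n : (0 < n.+1%:R^-1 :> R)%R by rewrite invr_gt0 ltr0n.
have invle i j : (i <= j)%N -> (j.+1%:R^-1 <= i.+1%:R^-1 :> R)%R.
  by move=> ij; rewrite lef_pV2 ?posrE ?ltr0n// ler_nat ltnS.
have small (e : R) : (0 < e)%R -> exists n, (n.+1%:R^-1 < e)%R.
  move=> e0; exists (Num.bound e^-1).
  rewrite invf_plt ?posrE ?ltr0n//.
  have : (0 <= e^-1)%R by rewrite invr_ge0 ltW.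
  move=> /archi_boundP /lt_trans; apply; by rewrite ltr_nat.
exists m; split => //.
- rewrite (_ : [set x | _] = \bigcup_n [set x | (m + n.+1%:R^-1 < f x)%R]); last first.
    apply/seteqP; split => x /=; last by move=> [n _] /=; apply: lt_trans; rewrite ltrDl.
    by rewrite -subr_gt0 => /small[n Hn]; exists n => //=; rewrite -ltrBrDl.
  apply: measure_bigcup_nondecreasing_le => [//|i j ij|i].
    apply/subsetPset => x /=; apply: le_lt_trans; by rewrite lerD2l invle.
  have [t [t0 St] tm] := inf_adherent (inv0 i) hS.
  by apply: le_trans St; apply: mono; exact: ltW.
- rewrite (_ : [set x | _] = \bigcup_n [set x | (f x <= m - n.+1%:R^-1)%R]); last first.
    apply/seteqP; split => x /=.
      rewrite -subr_gt0 => /small[n Hn]; exists n => //=.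
      by rewrite lerBrDr -lerBrDl ltW.
    by move=> [n _] /= H; apply: le_lt_trans H _; rewrite ltrBlDr ltrDl.
  apply: measure_bigcup_nondecreasing_le => [//|i j ij|i].
    apply/subsetPset => x /= /le_trans; apply; by rewrite lerD2l lerN2 invle.
  rewrite leNgt; apply/negP => H.
  have [t0|t0] := leP 0%R (m - i.+1%:R^-1)%R.
    have : S (m - i.+1%:R^-1)%R by split => //; rewrite half ltW.
    by move=> /(ge_inf hS.2); rewrite -/m lerBrDr gerDl leNgt inv0.
  move: H; rewrite (_ : [set x | _] = set0) ?measure0 ?lte_fin; first by lra.
  apply/seteqP; split => x //= H.
  by have := le_lt_trans (le_trans (f0 x) H) t0; rewrite ltxx.
Qed.

End median.

(** * Assembly of the inequality *)

Lemma powR_inv_le (R : realType) (q K s E a : R) : (0 < q -> 0 < K ->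
  0 <= E -> 0 <= a ->
  (forall B, s `^ (1 - q) * (16 * E) `^ q < B -> a <= K * B) ->
  a `^ q^-1 <= 16 * K `^ q^-1 * s `^ ((1 - q) / q) * E)%R.
Proof.
move=> q0 K0 E0 a0; set J := (s `^ (1 - q) * _)%R => H.
have J0 : (0 <= J)%R by rewrite mulr_ge0 ?powR_ge0.
have aJ : (a <= K * J)%R.
  apply/ler_addgt0Pr => e e0.
  have : (J < J + e / K)%R by rewrite ltrDl divr_gt0.
  by move=> /H; rewrite mulrDr (mulrC K (e / K)%R) divfK// gt_eqF.
apply: (@le_trans _ _ ((K * J) `^ q^-1)%R).
  apply: ge0_ler_powR; rewrite ?nnegrE ?invr_ge0 ?(ltW q0)//.
  by rewrite mulr_ge0// ltW.
rewrite powRM ?(ltW K0)// /J powRM ?powR_ge0// -!powRrM mulfV ?gt_eqF//.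
by rewrite powRr1 ?mulr_ge0// le_eqVlt; apply/orP; left; apply/eqP; ring.
Qed.

Theorem theorem2p5 (R : realType) (q : R) (q_gt0 : (0 < q)%R) (q_lt1 : (q < 1)%R) :
  exists kappa : R, (0 < kappa)%R /\
    forall (n : nat) (M : riemannianManifold R n)
      (mu : probability (borel M) R)
      (nu : {measure set (borel M) -> \bar R}),
      beta_LS q mu nu < +oo ->
      exists C : R, [/\ (0 <= C)%R,
        C%:E <= kappa%:E * beta_LS q mu nu &
        Lq_logSobolev q mu nu C].
Proof.
pose K : R := (1 + 18 * expR 2)%R.
have K0 : (0 < K)%R by rewrite ltr_wpDr// mulr_ge0// expR_ge0.
exists (16 * K `^ q^-1)%R; split; first by rewrite mulr_gt0// powR_gt0.
move=> n M mu nu; rewrite /beta_LS -/(LS_sup q mu nu); set S := LS_sup q mu nu.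
have r0 : (0 < (1 - q) / q)%R by rewrite divr_gt0// subr_gt0.
move=> bfin.
have Sfin : S < +oo by apply: lty_poweRy bfin; rewrite gt_eqF.
have bE : S `^ ((1 - q) / q) = (fine S `^ ((1 - q) / q))%:E.
  rewrite -fine_poweR fineK// ge0_fin_numE// poweR_ge0//.
exists (16 * K `^ q^-1 * fine S `^ ((1 - q) / q))%R; split.
- by rewrite !mulr_ge0 ?powR_ge0.
- by rewrite bE -EFinM.
move=> f fC f0 Efin.
have mf : measurable_fun setT (f : borel M -> R).
  apply: (measurability _ (RGenOInfty.measurableE R)) => _ [_ [a ->] <-].
  rewrite setTI preimage_itvoy; exact: measurable_superlevel.
have [m [m0 mu_gt mu_lt]] := @median_ge0 _ (borel M) R mu f mf f0.
(* Both shifts by the median have the energy of [f] and are positive on a set of measure at most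
   1/2. *)
have du (t : R) : (is_derive t 1 (fun s : R => s - m) (1 - 0))%R.
  exact: is_deriveB.
have dl (t : R) : (is_derive t 1 (fun s : R => m - s) (0 - 1))%R.
  exact: is_deriveB.
have [uC uG] := C1_comp fC du (fun=> cvg_cst _).
have [lC lG] := C1_comp fC dl (fun=> cvg_cst _).
have Eu : energy nu ((fun t => t - m)%R \o f) = energy nu f.
  by apply: eq_integral => x _; rewrite uG subr0 expr1n mul1r.
have El : energy nu ((fun t => m - t)%R \o f) = energy nu f.
  by apply: eq_integral => x _; rewrite lG sub0r sqrrN expr1n mul1r.
pose E := fine (energy nu f).
have E0 : (0 <= E)%R by exact: (fine_ge0 (energy_ge0 nu f)).
pose J : R := (fine S `^ (1 - q) * (16 * E) `^ q)%R.
have J0 : (0 <= J)%R by rewrite mulr_ge0 ?powR_ge0.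
have Hu (s : seq int) : uniq s -> (\sum_(j <- s) rad R j `^ (2 * q) *
    entlog (fine (mu [set x | (rad R j < f x - m)%R]%classic)) <= J)%R.
  move=> us; have := level_sum_le q_gt0 q_lt1 (mu := mu) uC us Sfin.
  rewrite Eu => /(_ Efin); apply; rewrite /superlevel.
  by under eq_set do rewrite /= subr_gt0.
have Hl (s : seq int) : uniq s -> (\sum_(j <- s) rad R j `^ (2 * q) *
    entlog (fine (mu [set x | (rad R j < m - f x)%R]%classic)) <= J)%R.
  move=> us; have := level_sum_le q_gt0 q_lt1 (mu := mu) lC us Sfin.
  rewrite El => /(_ Efin); apply; rewrite /superlevel.
  by under eq_set do rewrite /= subr_gt0.
have mfp : measurable_fun setT (fun x : borel M => f x `^ (2 * q))%R.
  exact: (measurableT_comp (@measurable_powR R (2 * q)%R) mf).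
(* [J] may be 0, whereas the reference [m^(2q) + B] needs [B > 0]; [powR_inv_le] lets [B] decrease
   to [J]. *)
have ent (B : R) : (J < B)%R ->
    0 <= entropy mu (fun x => f x `^ (2 * q))%R <= (K * B)%:E.
  move=> JB; have B0 := le_lt_trans J0 JB.
  apply: (@entropy_le R M mu (fun x => f x `^ (2 * q))%R (m `^ (2 * q) + B)%R (K * B)%R).
  - exact: mfp.
  - by move=> x; apply: powR_ge0.
  - exact: (ltr_wpDl (powR_ge0 m (2 * q)%R) B0).
  have p0 : (0 < 2 * q)%R by rewrite mulr_gt0.
  have p2 : (2 * q < 2)%R by rewrite -[ltRHS]mulr1 ltr_pM2l.
  exact: (@integral_kl_density_le _ (borel M) R mu (2 * q)%R p0 p2 f m B mf f0 m0 B0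
    (fun s us => le_trans (Hu s us) (ltW JB)) (fun s us => le_trans (Hl s us) (ltW JB))).
have EE : energy nu f = E%:E.
  apply/esym/fineK; rewrite ge0_fin_numE; [exact: Efin|exact: energy_ge0].
rewrite EE -EFinM.
(* This instance only excludes infinite values of the entropy. *)
have := ent (J + 1)%R; rewrite ltrDl ltr01 => /(_ isT).
move: ent; case: (entropy _ _) => [a|_ /andP[]//|_ /andP[]//] ent /andP[a0 _].
rewrite poweR_EFin lee_fin.
apply: (powR_inv_le q_gt0 K0 E0); first by rewrite -lee_fin.
by move=> B /ent /andP[_]; rewrite lee_fin.
Qed.
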